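(* Let $P$ and $Q$ be probability measures on a measurable space $\mathcal{X}$, let $Q = Q_a + Q_s$ be the Lebesgue decomposition of $Q$ with respect to $P$ ($Q_a \ll P$, $Q_s \perp P$), and let $U : [0,\infty] \to [-\infty,\infty]$ be measurable. Suppose that for some $\lambda \in [0,\infty)$, $\varepsilon^*$ is a valid e-value for $H=\{P\}$ that satisfies $$\varepsilon^*(x) \in \operatorname*{arg\,max}_{z \in [0,\infty)} \left\{\frac{dQ_a}{dP}(x)\, U(z) - \lambda z\right\}, \quad P\text{-a.s.},$$ with $\lambda\,(1 - \mathrm{E}^P[\varepsilon^*]) = 0$, and with $U(\varepsilon^* )$ finite $Q_a$-almost surely. Then $\varepsilon^*$ is $U$-optimal.
   Context: Notation: $\mathrm{E}^\mu[f]=\int f\,d\mu$ for any nonnegative measure $\mu$; $dQ_a/dP$ is a $[0,\infty)$-valued version of the Radon--Nikodym derivative; convention $0\times U(z)=0$. An e-value is a measurable map $\varepsilon:\mathcal{X}\to[0,\infty]$; it is valid for the simple hypothesis $H=\{P\}$ if $\mathrm{E}^P[\varepsilon]\le 1$. A valid e-value $\varepsilon^*$ is $U$-optimal (against $Q_a$) if, for every valid e-value $\varepsilon$, $\mathrm{E}^{Q_a}[U(\varepsilon^* )-U(\varepsilon)]$ is well-defined and $\geq 0$. Here ''well-defined'' means that the integrand avoids an ambiguous $\infty-\infty$ $Q_a$-almost surely, and that its positive part or its negative part has finite $Q_a$-expectation. *)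

(* Defs.v *)
From HB Require Import structures.
From mathcomp Require Export all_boot all_order all_algebra.
From mathcomp Require Export all_classical all_reals all_analysis measurable_realfun.
Export Order.TTheory GRing.Theory Num.Theory.
Export numFieldNormedType.Exports.

Set Implicit Arguments.
Unset Strict Implicit.
Unset Printing Implicit Defensive.

Local Open Scope classical_set_scope.
Local Open Scope ring_scope.
Local Open Scope ereal_scope.

Section defs.
Context (d : measure_display) (X : measurableType d) (R : realType).
Implicit Types (mu nu P Q Qa Qs : {measure set X -> \bar R}) (eps : X -> \bar R).

Definition mutually_singular mu nu : Prop :=
  exists N, [/\ measurable N, mu N = 0 & nu (~` N) = 0].

Definition is_lebesgue_decomposition Q P Qa Qs : Prop :=
  [/\ forall A, measurable A -> Q A = Qa A + Qs A,
      Qa `<< P & mutually_singular Qs P].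

(* The library's ['d nu '/d mu] is one fixed version, possibly negative on a
   null set; here [f] ranges over all [0, oo)-valued versions. *)
Definition is_RN_version nu mu (f : X -> R) : Prop :=
  [/\ measurable_fun setT f, forall x, (0 <= f x)%R &
      forall A, measurable A -> nu A = \int[mu]_(x in A) (f x)%:E].

Definition is_evalue eps : Prop :=
  measurable_fun setT eps /\ forall x, 0 <= eps x.

(* Validity for the simple hypothesis {P}. *)
Definition valid_evalue P eps : Prop :=
  is_evalue eps /\ \int[P]_x eps x <= 1.

(* In [\bar R], [+oo - +oo] and [-oo - -oo] are [-oo]; the first clause says
   that these cases only occur on a null set. *)
Definition diff_expectation_defined mu (f g : X -> \bar R) : Prop :=
  (\forall x \ae mu, adde_def (f x) (- g x)) /\
  (\int[mu]_x ((f \- g)^\+ x) < +oo \/ \int[mu]_x ((f \- g)^\- x) < +oo).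

(* A utility on [0, oo] is a function on [\bar R] of which only the values at
   nonnegative arguments are used. *)
Definition U_optimal P Qa (U : \bar R -> \bar R) eps_star : Prop :=
  valid_evalue P eps_star /\
  forall eps, valid_evalue P eps ->
    diff_expectation_defined Qa (U \o eps_star) (U \o eps) /\
    0 <= \int[Qa]_x (U (eps_star x) - U (eps x)).

End defs.

Definition argmax (R : realType) (T : Type) (D : set T) (g : T -> \bar R) :
  set T := [set z | D z /\ forall y, D y -> g y <= g z].

(* Main.v *)
Require Import Defs.
From mathcomp Require Import lra.

(** Write q for a version of dQ_a/dP and e* for the candidate.  The proof is
    weak Lagrangian duality, done pointwise and then integrated.

    Let e be a competitor with E^P[e] <= 1, and D = U(e* ) - U(e).  As e is
    P-a.s. finite, its value may be compared with the maximizer e* :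
    q U(e) - lambda e <= q U(e* ) - lambda e*.  When q > 0, U(e* ) is finite,
    and this becomes q D >= lambda (e* - e).  Split into positive and negative
    parts, so that no infinite quantity is ever subtracted, it yields
    q D^- <= lambda e [lagrangian_neg_le] and
    q D^- + lambda e* <= q D^+ + lambda e [lagrangian_le]; where q = 0 both
    hold as well, because 0 * U(z) = 0.

    Integrate against P, using that \int g dQ_a = \int g q dP for g >= 0
    [ge0_integral_density].  The first inequality gives
    E^{Q_a}[D^-] <= lambda, so that the expectation of D is well-defined.  By
    complementary slackness lambda E^P[e* ] = lambda >= lambda E^P[e], so the
    second gives E^{Q_a}[D^-] + lambda <= E^{Q_a}[D^+] + lambda, that is,
    E^{Q_a}[D] >= 0.

    Finiteness of U(e* ) is known Q_a-a.s. only; [ae_density] turns it into a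
    P-a.s. statement on the set where q > 0, which is all the pointwise step
    asks for. *)

Local Open Scope classical_set_scope.
Local Open Scope ring_scope.
Local Open Scope ereal_scope.

(** * Integration against a measure with a density *)

Section density.
Set Implicit Arguments.
Unset Strict Implicit.
Context (d : measure_display) (X : measurableType d) (R : realType).
Context (mu nu : {measure set X -> \bar R}) (f : X -> R).
Context (RN : is_RN_version nu mu f).

Import HBNNSimple.

Let mf : measurable_fun setT f. Proof. by case: RN. Qed.
Let f_ge0 x : (0 <= f x)%R. Proof. by case: RN. Qed.
Let nuE A : measurable A -> nu A = \int[mu]_(x in A) (f x)%:E.
Proof. by case: RN => _ _; exact. Qed.

(** By linearity this reduces to indicators, where it is the defining property
    of a density. *)
Lemma integral_nnsfun_density (h : {nnsfun X >-> R}) :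
  \int[nu]_x (h x)%:E = \int[mu]_x ((h x)%:E * (f x)%:E).
Proof.
rewrite integralT_nnsfun sintegralE.
under [RHS]eq_integral => x _.
  rewrite fimfunE -fsumEFin// ge0_mule_fsuml; last first.
    by move=> y; rewrite EFinM; exact: nnfun_muleindic_ge0.
  over.
rewrite ge0_integral_fsum//; last 2 first.
- move=> y; apply: emeasurable_funM; apply/measurable_EFinP => //.
  exact: measurable_funM.
- move=> y x _; rewrite mule_ge0 ?lee_fin ?f_ge0//.
  by rewrite -lee_fin EFinM; exact: nnfun_muleindic_ge0.
apply: eq_fsbigr => y; rewrite inE => -[x _ <-].
rewrite nuE// [in LHS]integral_mkcond -ge0_integralZl_EFin//; last 2 first.
- by move=> z _; rewrite patchE; case: ifP => // _; rewrite lee_fin.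
- apply/(measurable_restrictT _ _).1 => //.
  exact/measurable_funTS/measurable_EFinP.
apply: eq_integral => z _.
rewrite patchE indicE; case: ifP => _.
  by rewrite mulr1.
by rewrite mulr0 mule0 mul0e.
Qed.

(** Monotone convergence passes from simple functions to [g], on both sides at
    once because multiplication by the finite, nonnegative density preserves
    increasing limits. *)
Lemma ge0_integral_density (g : X -> \bar R) :
  measurable_fun setT g -> (forall x, 0 <= g x) ->
  \int[nu]_x g x = \int[mu]_x (g x * (f x)%:E).
Proof.
move=> mg g_ge0; pose h := nnsfun_approx measurableT mg.
have cvgh x : (h n x)%:E @[n --> \oo] --> g x.
  exact: (cvg_nnsfun_approx measurableT mg).
have ndh x : {homo (fun n => h n x) : n m / (n <= m)%N >-> (n <= m)%R}.
  by move=> n m nm; exact/lefP/nd_nnsfun_approx.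
have -> : \int[nu]_x g x = limn (fun n => \int[nu]_x (h n x)%:E).
  rewrite -monotone_convergence//.
  - by apply: eq_integral => x _; apply/esym/cvg_lim => //; exact: cvgh.
  - by move=> n; exact/measurable_EFinP.
  - by move=> n x _; rewrite lee_fin.
  - by move=> x _ n m nm; rewrite lee_fin ndh.
have -> : \int[mu]_x (g x * (f x)%:E) =
    limn (fun n => \int[mu]_x ((h n x)%:E * (f x)%:E)).
  rewrite -monotone_convergence//.
  - apply: eq_integral => x _; apply/esym/cvg_lim => //.
    by apply: cvgeZr => //; exact: cvgh.
  - by move=> n; apply: emeasurable_funM; exact/measurable_EFinP.
  - by move=> n x _; rewrite mule_ge0 ?lee_fin.
  - by move=> x _ n m nm; rewrite lee_wpmul2r ?lee_fin// ndh.
by congr (limn _); apply/funext => n; exact: integral_nnsfun_density.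
Qed.

(** A [nu]-null set is one on which the density vanishes [mu]-almost everywhere,
    and conversely [nu] does not charge the zero set of the density. *)
Lemma ae_density (phi : X -> Prop) :
  (\forall x \ae nu, phi x) <-> (\forall x \ae mu, (0 < f x)%R -> phi x).
Proof.
split=> -[N [mN N0 phiN]].
- have : ae_eq mu N (EFin \o f) (cst 0).
    apply/ae_eq_integral_abs => //.
      exact/measurable_funTS/measurable_EFinP.
    rewrite -[RHS]N0 nuE//; apply: eq_integral => x _ /=.
    by rewrite ger0_norm.
  apply: filterS => x fx fx_gt0; apply: contrapT => nphi.
  have /fx/= [fx0] : N x by exact: phiN.
  by rewrite fx0 ltxx in fx_gt0.
- have mZ : measurable (f @^-1` [set 0%R]).
    by rewrite -[X in measurable X]setTI; exact: mf.
  exists (N `|` f @^-1` [set 0%R]); split; first exact: measurableU.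
    apply: null_set_setU => //.
      rewrite nuE//; apply: null_set_integral => //.
      exact/measurable_funTS/measurable_EFinP.
    by rewrite nuE//; apply: integral0_eq => x /= ->.
  move=> x /= nphi; have [fx0|fx0] := eqVneq (f x) 0%R; first by right.
  left; apply: phiN => /= phix; apply/nphi/phix.
  by rewrite lt0r fx0 f_ge0.
Qed.

End density.

(** * The pointwise Lagrangian inequalities *)

Section pointwise.
Set Implicit Arguments.
Unset Strict Implicit.
Context (R : realType) (q l : R) (s t a b : \bar R).
Context (q0 : (0 <= q)%R) (l0 : (0 <= l)%R) (s0 : 0 <= s) (t0 : 0 <= t).
Context (sfin : s \is a fin_num) (tfin : t \is a fin_num).
Context (afin : (0 < q)%R -> a \is a fin_num).
Context (ab : q%:E * b - l%:E * t <= q%:E * a - l%:E * s).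

(** In the application [a] = U(e* ), [b] = U(e), [s] = e*, [t] = e, [q] is the
    density and [l] the multiplier.  The bound makes the negative part of the
    utility difference integrable; it follows from q (b - a) <= l (t - s) by
    dropping - l s <= 0. *)
Lemma lagrangian_neg_le : maxe (- (a - b)) 0 * q%:E <= l%:E * t.
Proof.
move: s t sfin tfin s0 t0 ab => [s'| |] // [t'| |] // _ _.
rewrite !lee_fin => s'0 t'0 ab'.
move: q0; rewrite le_eqVlt => /predU1P[q00|qgt0].
  by rewrite -q00 mule0 mule_ge0 ?lee_fin.
have := afin qgt0; move: a b ab' => [a'| |] // [b'| |] //= + _.
- rewrite -!EFinM -!EFinB -EFin_max -EFinM !lee_fin => h.
  have ls0 := mulr_ge0 l0 s'0; have lt0 := mulr_ge0 l0 t'0.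
  by rewrite maxr_pMl// ge_max; apply/andP; split; lra.
- by rewrite gt0_muley// lte_fin.
- by rewrite max_r// mul0e mule_ge0 ?lee_fin.
Qed.

(** The inequality q (a - b) >= l (s - t), with every term moved to the side
    where it is nonnegative: it can then be integrated term by term even when
    [a - b] is infinite. *)
Lemma lagrangian_le :
  maxe (- (a - b)) 0 * q%:E + l%:E * s <= maxe (a - b) 0 * q%:E + l%:E * t.
Proof.
move: s t sfin tfin s0 t0 ab => [s'| |] // [t'| |] // _ _.
rewrite !lee_fin => s'0 t'0 ab'.
move: q0; rewrite le_eqVlt => /predU1P[q00|qgt0].
  (* The utilities disappear from the hypothesis since 0 * U(z) = 0. *)
  move: a b ab'; rewrite -q00 => a0 b0; rewrite !mule0 !mul0e !sub0e !add0e.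
  by rewrite leeN2.
have := afin qgt0; move: a b ab' => [a'| |] // [b'| |] //= + _.
- rewrite -!EFinM -!EFinB -!EFin_max -!EFinM -!EFinD !lee_fin => h.
  rewrite -lerBrDr -addrA -lerBlDl -mulrBl.
  have [D0|D0] := leP 0%R (a' - b')%R.
    by rewrite max_r ?oppr_le0//; lra.
  by rewrite max_l ?oppr_ge0 ?(ltW D0)//; lra.
- by rewrite gt0_muley// lte_fin.
- by move=> _; rewrite addey// (max_l (leey _)) gt0_mulye ?lte_fin// addye// leey.
Qed.
End pointwise.

(** * Optimality *)

Theorem theorem1 (d : measure_display) (X : measurableType d) (R : realType)
  (P Q : probability X R) (Qa Qs : {measure set X -> \bar R})
  (hQ : is_lebesgue_decomposition Q P Qa Qs)
  (dQa_dP : X -> R) (hdQa_dP : is_RN_version Qa P dQa_dP)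
  (U : \bar R -> \bar R)
  (mU : measurable_fun [set z : \bar R | 0 <= z] U)
  (lambda : R) (lambda_ge0 : (0 <= lambda)%R)
  (eps_star : X -> \bar R) (veps : valid_evalue P eps_star)
  (hargmax : \forall x \ae P,
     argmax [set z : \bar R | 0 <= z < +oo]
       (fun z => (dQa_dP x)%:E * U z - lambda%:E * z) (eps_star x))
  (hlambda : lambda%:E * (1 - \int[P]_x eps_star x) = 0)
  (hUfin : \forall x \ae Qa, U (eps_star x) \is a fin_num) :
  U_optimal P Qa U eps_star.
Proof.
split=> // eps [[meps eps_ge0] eps_le1].
have [[mstar star_ge0] star_le1] := veps.
have [mf f_ge0 _] := hdQa_dP.
have mUo g : measurable_fun setT g -> (forall x, 0 <= g x) ->
    measurable_fun [set: X] (U \o g).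
  move=> mg g_ge0; apply: (@measurable_comp _ _ _ _ _ _ [set z : \bar R | 0 <= z]) => //.
    rewrite [X in measurable X](_ : _ = `[0, +oo]%classic); last first.
      by apply/seteqP; split => z /=; rewrite in_itv/= leey ?andbT.
    exact: emeasurable_itv.
  by move=> _ [x _ <-] /=.
pose D := (U \o eps_star) \- (U \o eps).
have mD : measurable_fun setT D by apply: emeasurable_funB; exact: mUo.
have mDp := measurable_funepos mD; have mDn := measurable_funeneg mD.
have Dp_ge0 x : 0 <= D^\+ x by exact: funepos_ge0.
have Dn_ge0 x : 0 <= D^\- x by exact: funeneg_ge0.
have lam_ge0 : 0 <= lambda%:E by rewrite lee_fin.
have mlam g : measurable_fun setT g -> measurable_fun [set: X] (fun x => lambda%:E * g x).
  by move=> mg; exact: emeasurable_funM.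
have mq g : measurable_fun setT g ->
    measurable_fun [set: X] (fun x => g x * (dQa_dP x)%:E).
  by move=> mg; apply: emeasurable_funM => //; exact/measurable_EFinP.
have eps_fin : \forall x \ae P, eps x \is a fin_num.
  have : P.-integrable setT eps.
    apply/integrableP; split=> //.
    under eq_integral => x _ do rewrite gee0_abs//.
    exact: le_lt_trans eps_le1 (ltry _).
  by move=> /(integrable_ae measurableT); apply: filterS => x; exact.
(* The maximum is over finite z only, so e may compete in it just where it is
   finite. *)
have key : \forall x \ae P,
    D^\- x * (dQa_dP x)%:E <= lambda%:E * eps x /\
    D^\- x * (dQa_dP x)%:E + lambda%:E * eps_star x <=
    D^\+ x * (dQa_dP x)%:E + lambda%:E * eps x.
  have /(ae_density hdQa_dP) hUfinP := hUfin.
  apply: filterS3 hargmax eps_fin hUfinP => x [/andP[_ star_fin] opt] epsx Ux.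
  have := opt (eps x); rewrite /= eps_ge0 ltey_eq epsx => /(_ isT).
  have starx : eps_star x \is a fin_num by rewrite ge0_fin_numE.
  rewrite funeposE funenegE /D /=.
  move=> h; split; [exact: lagrangian_neg_le h|exact: lagrangian_le h].
have int_eps : \int[P]_x (lambda%:E * eps x) <= lambda%:E.
  by rewrite ge0_integralZl_EFin// -[leRHS]mule1 lee_wpmul2l.
(* Complementary slackness; when lambda = 0 both sides vanish. *)
have int_star : \int[P]_x (lambda%:E * eps_star x) = lambda%:E.
  rewrite ge0_integralZl_EFin//.
  have : 0 <= \int[P]_x eps_star x by exact: integral_ge0.
  move: hlambda star_le1; case: (\int[P]_x eps_star x) => [m| |]//.
  rewrite -EFinB -EFinM => -[lm] _ _; congr EFin; move: lm; rewrite mulrBr mulr1.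
  by move/eqP; rewrite subr_eq0 => /eqP.
have Dn_le : \int[Qa]_x D^\- x <= lambda%:E.
  rewrite (ge0_integral_density hdQa_dP)//; apply: le_trans int_eps.
  apply: ae_ge0_le_integral => //.
  - by move=> x _; rewrite mule_ge0// lee_fin.
  - exact: mq.
  - by move=> x _; rewrite mule_ge0.
  - exact: mlam.
  - by apply: filterS key => x [].
have Dn_lty : \int[Qa]_x D^\- x < +oo by exact: le_lt_trans Dn_le (ltry _).
split.
  split; last by right.
  by apply: filterS hUfin => x Ux; exact: fin_num_adde_defr.
(* Adding lambda, which is finite, to both sides of D^- <= D^+ (integrated)
   makes room for the integrals of lambda e* and lambda e. *)
change (0 <= \int[Qa]_x D x).
rewrite integralE sube_ge0; last by rewrite ge0_fin_numE ?Dn_lty ?orbT// integral_ge0.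
rewrite -(@leeD2rE _ lambda%:E)//.
apply: le_trans (leeD (lexx _) int_eps).
rewrite -{1}int_star !(ge0_integral_density hdQa_dP)//.
rewrite -!ge0_integralD//; do ?[by move=> x _; rewrite mule_ge0// lee_fin];
  do ?[exact: mq|exact: mlam].
apply: ae_ge0_le_integral => //.
- by move=> x _; rewrite adde_ge0// mule_ge0// lee_fin.
- by apply: emeasurable_funD; [exact: mq|exact: mlam].
- by move=> x _; rewrite adde_ge0// mule_ge0// lee_fin.
- by apply: emeasurable_funD; [exact: mq|exact: mlam].
- by apply: filterS key => x [].
Qed.
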